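(* Let $d\in\{2,3\}$ and let $\mathbf{u}$ be a differentiable vector field with values in $\mathbb{C}^d$. At every point of the surface, with unit normal $\boldsymbol{\nu}$ (and, for $d=2$, unit tangent $\boldsymbol{\tau}=\boldsymbol{\nu}^\perp$), the generalized stress vector $\mathbf{P}_{\tilde\mu,\tilde\lambda}\mathbf{u}$ satisfies $$\mathbf{P}_{\tilde\mu,\tilde\lambda}\mathbf{u}=\begin{cases}(\mu+\tilde{\mu})(\partial_{\boldsymbol{\tau}}\mathbf{u})^\perp+(2\mu+\lambda)\,\boldsymbol{\nu}\,\mathrm{div}\,\mathbf{u}+\mu\,\boldsymbol{\tau}\,\mathrm{div}^\perp\mathbf{u}, & d=2,\\ (\mu+\tilde{\mu})\,\mathcal{M}_{\boldsymbol{\nu}}(\mathbf{u})+(2\mu+\lambda)\,\boldsymbol{\nu}\,\mathrm{div}\,\mathbf{u}-\mu\,\boldsymbol{\nu}\times\mathrm{curl}\,\mathbf{u}, & d=3,\end{cases}$$ where, for $\mathbf{u}=(u_1,u_2,u_3)^\top$ and $\boldsymbol{\nu}=(\nu_1,\nu_2,\nu_3)^\top$, $$\mathcal{M}_{\boldsymbol{\nu}}(\mathbf{u}):=\begin{pmatrix}\nu_2\partial_1u_2-\nu_1\partial_2u_2+\nu_3\partial_1u_3-\nu_1\partial_3u_3\\ \nu_1\partial_2u_1-\nu_2\partial_1u_1+\nu_3\partial_2u_3-\nu_2\partial_3u_3\\ \nu_1\partial_3u_1-\nu_3\partial_1u_1+\nu_2\partial_3u_2-\nu_3\partial_2u_2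\end{pmatrix}.$$
   Context: The Lamé constants $\lambda,\mu\in\mathbb{R}$ satisfy $\mu>0$ and $d\lambda+2\mu>0$; $\tilde\mu,\tilde\lambda\in\mathbb{R}$ satisfy $\tilde\mu+\tilde\lambda=\mu+\lambda$. For $d=2$ and $\mathbf{y}=(y_1,y_2)^\top$ put $\mathbf{y}^\perp:=(y_2,-y_1)^\top$, $\mathrm{div}^\perp\mathbf{u}:=\partial_2u_1-\partial_1u_2$, and $\boldsymbol{\tau}:=\boldsymbol{\nu}^\perp$. $\partial_{\boldsymbol\nu}$ and $\partial_{\boldsymbol\tau}$ are the directional derivatives along $\boldsymbol\nu$ and $\boldsymbol\tau$, applied componentwise. The generalized stress vector with respect to the unit vector $\boldsymbol{\nu}$ is $$\mathbf{P}_{\tilde\mu,\tilde\lambda}\mathbf{u}:=\begin{cases}(\mu+\tilde{\mu})\partial_{\boldsymbol{\nu}}\mathbf{u}+\tilde{\lambda}\,\boldsymbol{\nu}\,\mathrm{div}\,\mathbf{u}-\tilde{\mu}\,\boldsymbol{\tau}\,\mathrm{div}^\perp\mathbf{u}, & d=2,\\ (\mu+\tilde{\mu})\partial_{\boldsymbol{\nu}}\mathbf{u}+\tilde{\lambda}\,\boldsymbol{\nu}\,\mathrm{div}\,\mathbf{u}+\tilde{\mu}\,\boldsymbol{\nu}\times\mathrm{curl}\,\mathbf{u}, & d=3.\end{cases}$$ *)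

(* Defs.v *)
From HB Require Import structures.
From mathcomp Require Import all_boot all_order all_algebra.
From mathcomp Require Import all_classical all_reals all_analysis.
From mathcomp Require Import complex.

Set Implicit Arguments.
Unset Strict Implicit.
Unset Printing Implicit Defensive.

Import Order.TTheory GRing.Theory Num.Theory.
Import numFieldNormedType.Exports.

Local Open Scope classical_set_scope.
Local Open Scope complex_scope.
Local Open Scope ring_scope.

(* [Rcomplex R] is [R[i]] seen as a normed space over the real field [R]; it is
   given here the topology of its norm, so that [R[i]]-valued functions of real
   variables can be differentiated. *)
Section Rcomplex_normedModType.
Variable R : realType.

Lemma RcomplexZ (l : R) (z : Rcomplex R) : `|l *: z| = `|l| * `|z|.
Proof.
case: z => a b; rewrite /Num.norm/=/(@Normc.normc R)/=.
by rewrite !exprMn -mulrDr sqrtrM ?sqr_ge0// sqrtr_sqr.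
Qed.

HB.instance Definition _ := isPointed.Build (Rcomplex R) 0.
HB.instance Definition _ :=
  PseudoMetric.copy (Rcomplex R) (pseudoMetric_normed (Rcomplex R)).
HB.instance Definition _ :=
  NormedZmod_PseudoMetric_eq.Build R (Rcomplex R) erefl.
HB.instance Definition _ :=
  PseudoMetricNormedZmod_Lmodule_isNormedModule.Build R (Rcomplex R) RcomplexZ.
End Rcomplex_normedModType.

Section vector_fields.
Context {R : realType}.

Section any_dimension.
Context {d : nat}.
Implicit Types (u : 'cV[R]_d -> 'cV[R[i]]_d) (x v : 'cV[R]_d).

Definition component u (i : 'I_d) : 'cV[R]_d -> Rcomplex R := fun x => u x i 0.

(* real differentiability, equivalent to that of each scalar component *)
Definition vfield_differentiable u x : Prop :=
  forall i, differentiable (component u i) x.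

Definition dir_derive v u x : 'cV[R[i]]_d := \col_i 'D_v (component u i) x.

(* [partial k u x i 0] is the partial derivative of [u_i] in the [k]-th
   variable; indices start at [0]. *)
Definition partial (k : 'I_d) u x : 'cV[R[i]]_d := dir_derive (delta_mx k 0) u x.

Definition divergence u x : R[i] := \sum_(i < d) partial i u x i 0.

(* A surface is an arbitrary subset [G] of R^d. [v] is a unit normal to [G] at
   [x] when it has Euclidean norm 1 (the norm [`|v|] of the library is the sup
   norm) and is orthogonal to the velocity at [x] of every curve in [G] through
   [x]. *)
Definition unit_normal (G : set 'cV[R]_d) x v : Prop :=
  \sum_(i < d) v i 0 ^+ 2 = 1 /\
  forall c : R -> 'cV[R]_d, c 0 = x -> (\forall t \near 0, G (c t)) ->
    derivable c 0 1 -> \sum_(i < d) v i 0 * 'D_1 c 0 i 0 = 0.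

Definition toC v : 'cV[R[i]]_d := map_mx (real_complex R) v.

End any_dimension.

Definition perp {K : pzRingType} (v : 'cV[K]_2) : 'cV[K]_2 :=
  \col_(i < 2) [:: v 1 0; - v 0 0]`_i.

Definition div_perp (u : 'cV[R]_2 -> 'cV[R[i]]_2) (x : 'cV[R]_2) : R[i] :=
  partial 1 u x 0 0 - partial 0 u x 1 0.

Definition cross {K : pzRingType} (v w : 'cV[K]_3) : 'cV[K]_3 :=
  \col_(i < 3) [:: v 1 0 * w 2 0 - v 2 0 * w 1 0;
                   v 2 0 * w 0 0 - v 0 0 * w 2 0;
                   v 0 0 * w 1 0 - v 1 0 * w 0 0]`_i.

Definition curl (u : 'cV[R]_3 -> 'cV[R[i]]_3) (x : 'cV[R]_3) : 'cV[R[i]]_3 :=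
  \col_(i < 3) [:: partial 1 u x 2 0 - partial 2 u x 1 0;
                   partial 2 u x 0 0 - partial 0 u x 2 0;
                   partial 0 u x 1 0 - partial 1 u x 0 0]`_i.

(* the generalized stress vector for [d = 2] and for [d = 3] *)
Definition stress2 (mu mut lat : R) (nu : 'cV[R]_2)
    (u : 'cV[R]_2 -> 'cV[R[i]]_2) (x : 'cV[R]_2) : 'cV[R[i]]_2 :=
  (mu + mut)%:C *: dir_derive nu u x
  + (lat%:C * divergence u x) *: toC nu
  - (mut%:C * div_perp u x) *: toC (perp nu).

Definition stress3 (mu mut lat : R) (nu : 'cV[R]_3)
    (u : 'cV[R]_3 -> 'cV[R[i]]_3) (x : 'cV[R]_3) : 'cV[R[i]]_3 :=
  (mu + mut)%:C *: dir_derive nu u x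
  + (lat%:C * divergence u x) *: toC nu
  + mut%:C *: cross (toC nu) (curl u x).

(* the operator M_nu, known as the matrix of Guenter derivatives *)
Definition guenter (nu : 'cV[R]_3) (u : 'cV[R]_3 -> 'cV[R[i]]_3)
    (x : 'cV[R]_3) : 'cV[R[i]]_3 :=
  let n (j : 'I_3) : R[i] := (nu j 0)%:C in
  let D (k j : 'I_3) : R[i] := partial k u x j 0 in
  \col_(i < 3)
    [:: n 1 * D 0 1 - n 0 * D 1 1 + n 2 * D 0 2 - n 0 * D 2 2;
        n 0 * D 1 0 - n 1 * D 0 0 + n 2 * D 1 2 - n 1 * D 2 2;
        n 0 * D 2 0 - n 2 * D 0 0 + n 1 * D 2 1 - n 2 * D 1 1]`_i.

End vector_fields.

(* Main.v *)
Require Import Defs.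
From mathcomp Require Import all_boot all_order all_algebra.
From mathcomp Require Import all_classical all_reals all_analysis.
From mathcomp Require Import complex.
From mathcomp Require Import ring.

Set Implicit Arguments.
Unset Strict Implicit.
Unset Printing Implicit Defensive.

Import Order.TTheory GRing.Theory Num.Theory.
Import numFieldNormedType.Exports.

Local Open Scope classical_set_scope.
Local Open Scope complex_scope.
Local Open Scope ring_scope.

(** In both dimensions the statement rests on a pointwise identity between first
    order operators that does not involve the material constants:
    - [d_nu u = perp (d_tau u) + (div u) nu + (div_perp u) tau] in the plane,
    - [d_nu u = M_nu u + (div u) nu - nu x curl u] in space
    (lemmas [normal_derivative2] and [normal_derivative3]).  Substituting it for
    [d_nu u] in the stress vector gives the divergence term the coefficient
    [mu + mut + lat], which is [2 mu + lam] by the constraint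
    [mut + lat = mu + lam], and the rotation term the coefficient [mu] in the
    plane and [- mu] in space, because the contribution of [mut] cancels.

    The two identities only express that a derivative along [v] is the
    combination of the partial derivatives with coefficients the entries of [v];
    this is where differentiability of [u] enters ([dir_derive_partial]).  In
    terms of the Jacobian matrix [J] of [u], they decompose [J nu] as
    [(J^T nu - (tr J) nu) + (tr J) nu + (J nu - J^T nu)], term by term. *)

(** The real scalar action on [Rcomplex R] agrees with multiplication by real
    complex numbers: this transfers the linearity of the differential, which
    holds over [R], to the complex coordinates used by the operators. *)
Lemma Rcomplex_scaleE (R : realType) (a : R) (z : Rcomplex R) :
  a *: z = a%:C * (z : R[i]) :> R[i].
Proof.
by case: z => p q; apply/eqP; rewrite eq_complex /= !mul0r subr0 addr0 !eqxx.
Qed.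

(** The differential of each component is linear, and [v] is the combination of
    the canonical basis vectors with coefficients its entries. *)
Lemma dir_derive_partial (R : realType) (d : nat)
    (u : 'cV[R]_d -> 'cV[R[i]]_d) (x v : 'cV[R]_d) (i : 'I_d) :
  vfield_differentiable u x ->
  dir_derive v u x i 0 = \sum_(k < d) (v k 0)%:C * partial k u x i 0.
Proof.
move=> /(_ i) du; rewrite mxE (deriveE _ du).
have -> : v = \sum_(k < d) v k 0 *: delta_mx k 0.
  by rewrite [LHS]matrix_sum_delta; apply: eq_bigr => k _; rewrite big_ord1.
rewrite linear_sum; apply: eq_bigr => k _.
rewrite linearZ /= Rcomplex_scaleE !mxE (deriveE _ du).
congr (_%:C * _).
rewrite summxE (bigD1 k) //= big1 => [|j jk]; first by rewrite !mxE !eqxx mulr1 addr0.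
by rewrite !mxE eq_sym (negPf jk) mulr0.
Qed.

Lemma sum_ord2 (V : nmodType) (F : 'I_2 -> V) : \sum_(k < 2) F k = F 0 + F 1.
Proof.
rewrite !big_ord_recl big_ord0 addr0.
by congr (_ + F _); apply: val_inj.
Qed.

Lemma sum_ord3 (V : nmodType) (F : 'I_3 -> V) :
  \sum_(k < 3) F k = F 0 + F 1 + F 2.
Proof.
rewrite !big_ord_recl big_ord0 addr0 addrA.
by congr (_ + F _ + F _); apply: val_inj.
Qed.

Lemma ord2_cases (i : 'I_2) : i = 0 \/ i = 1.
Proof. by case: i => [[|[|//]] ?]; [left | right]; apply: val_inj. Qed.

Lemma ord3_cases (i : 'I_3) : [\/ i = 0, i = 1 | i = 2].
Proof.
by case: i => [[|[|[|//]]] ?]; [constructor 1 | constructor 2 | constructor 3];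
  apply: val_inj.
Qed.

(** With [J] the Jacobian matrix of [u], rotating the tangential derivative gives
    [J^T nu - (tr J) nu]: a 2 x 2 matrix conjugated by the quarter turn is its
    adjugate up to transposition.  The last term is [J nu - J^T nu], since the
    antisymmetric part of [J] is a multiple of the quarter turn. *)
Lemma normal_derivative2 (R : realType) (nu : 'cV[R]_2)
    (u : 'cV[R]_2 -> 'cV[R[i]]_2) (x : 'cV[R]_2) :
  vfield_differentiable u x ->
  dir_derive nu u x = perp (dir_derive (perp nu) u x)
    + divergence u x *: toC nu + div_perp u x *: toC (perp nu).
Proof.
move=> du; have := fun v i => dir_derive_partial v i du.
rewrite /divergence /div_perp.
(* The operators become variables so that [mxE] does not unfold them. *)
move: (@partial R 2) (@dir_derive R 2) => D dD dDE.
apply/colP => i; rewrite !mxE !dDE !sum_ord2.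
by have [->|->] := ord2_cases i; rewrite !mxE /= rmorphN /=; ring.
Qed.

(** Here [M_nu u] equals [J^T nu - (tr J) nu], where [J] is the Jacobian matrix
    of [u], and [nu x curl u] equals [J^T nu - J nu]. *)
Lemma normal_derivative3 (R : realType) (nu : 'cV[R]_3)
    (u : 'cV[R]_3 -> 'cV[R[i]]_3) (x : 'cV[R]_3) :
  vfield_differentiable u x ->
  dir_derive nu u x = guenter nu u x
    + divergence u x *: toC nu - cross (toC nu) (curl u x).
Proof.
move=> du; have := fun v i => dir_derive_partial v i du.
rewrite /divergence /curl /guenter.
(* As in the plane, [mxE] must not see through the operators. *)
move: (@partial R 3) (@dir_derive R 3) => D dD dDE.
apply/colP => i; rewrite !mxE !dDE !sum_ord3.
by have [->|->|->] := ord3_cases i; rewrite /= ?mxE /=; ring.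
Qed.

Theorem lemma2p1 (R : realType) (lam mu mut lat : R)
    (mu_gt0 : 0 < mu) (lame_sum : mut + lat = mu + lam) :
  (* d = 2 *)
  (0 < 2 * lam + 2 * mu ->
   forall (G : set 'cV[R]_2) (nu : 'cV[R]_2 -> 'cV[R]_2)
          (u : 'cV[R]_2 -> 'cV[R[i]]_2),
     (forall x, G x -> unit_normal G x (nu x)) ->
     (forall x, G x -> vfield_differentiable u x) ->
     forall x, G x ->
       stress2 mu mut lat (nu x) u x =
       (mu + mut)%:C *: perp (dir_derive (perp (nu x)) u x)
       + ((2 * mu + lam)%:C * divergence u x) *: toC (nu x)
       + (mu%:C * div_perp u x) *: toC (perp (nu x)))
  /\
  (* d = 3 *)
  (0 < 3 * lam + 2 * mu ->
   forall (G : set 'cV[R]_3) (nu : 'cV[R]_3 -> 'cV[R]_3)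
          (u : 'cV[R]_3 -> 'cV[R[i]]_3),
     (forall x, G x -> unit_normal G x (nu x)) ->
     (forall x, G x -> vfield_differentiable u x) ->
     forall x, G x ->
       stress3 mu mut lat (nu x) u x =
       (mu + mut)%:C *: guenter (nu x) u x
       + ((2 * mu + lam)%:C * divergence u x) *: toC (nu x)
       - mu%:C *: cross (toC (nu x)) (curl u x)).
Proof.
(* The divergence receives [mu + mut] from the normal derivative and [lat] from
   the stress itself. *)
have coefE : (2 * mu + lam)%:C = (mu + mut)%:C + lat%:C.
  by rewrite -rmorphD /= -addrA lame_sum; congr _%:C; ring.
split=> _ G nu u _ du x Gx.
- rewrite /stress2 (normal_derivative2 _ (du x Gx)) coefE rmorphD /=.
  move: (perp (dir_derive _ _ _)) (toC _) (toC _) => p n t.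
  by apply/colP => i; rewrite !mxE; ring.
- rewrite /stress3 (normal_derivative3 _ (du x Gx)) coefE rmorphD /=.
  move: (guenter _ _ _) (toC _) => m n.
  move: (cross _ _) => c.
  by apply/colP => i; rewrite !mxE; ring.
Qed.
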